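(* Whenever $\Pi_3(\mathbf{k},\mathbf{k}')$ is an SB-group (i.e. torsion free), it has the $R_\infty$ property; and whenever $\Pi_6(\mathbf{k},\mathbf{k}')$ is an SB-group (i.e. torsion free), it has the $R_\infty$ property.
   Context: Let $A=[\ell_{ij}]\in\mathrm{SL}(2,\mathbb{Z})$ have trace $>2$. For $\mathbf{x}=(x,y)^t\in\mathbb{Z}^2$ write $\mathbf{a}^{\mathbf{x}}=a_1^xa_2^y$; for an integer matrix $B=[b_{ij}]$ write $B(a_i)=a_1^{b_{1i}}a_2^{b_{2i}}$. Kernels and images of integer matrices are taken on $\mathbb{Z}^2$; parameters lying in quotient groups are given by representatives in $\mathbb{Z}^2$. (i) $\Pi_3(\mathbf{k},\mathbf{k}')$: let $M=\begin{bmatrix}-1&m\\0&1\end{bmatrix}$ with $m\in\{0,1\}$ and $MAM^{-1}=A^{-1}$, and $(\mathbf{k},\mathbf{k}'-\mathbf{k})\in\frac{\ker(I-M)}{\mathrm{im}(I+M)}\oplus\frac{\ker(A-M)}{\mathrm{im}(A^{-1}+M)}$. Then $$\Pi_3(\mathbf{k},\mathbf{k}')=\langle a_1,a_2,t,\beta\mid [a_1,a_2]=1,\ ta_it^{-1}=A(a_i),\ \beta a_i\beta^{-1}=M(a_i),\ \beta^2=\mathbf{a}^{\mathbf{k}},\ \beta t\beta^{-1}=\mathbf{a}^{\mathbf{k}'}t^{-1}\rangle.$$ (ii) $\Pi_6(\mathbf{k},\mathbf{k}')$: assume $A$ has the integer square root $N=-\frac{1}{\sqrt{\ell_{11}+\ell_{22}+2}}\begin{bmatrix}\ell_{11}+1&\ell_{12}\\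 \ell_{21}&\ell_{22}+1\end{bmatrix}$; let $M$ be a traceless integer matrix with determinant $-1$ and $MAM^{-1}=A^{-1}$, and $(\mathbf{k},\mathbf{k}'-\mathbf{k})\in\frac{\ker(I-M)}{\mathrm{im}(I+M)}\oplus\frac{\ker(N-M)}{\mathrm{im}(N^{-1}+M)}$. Then $$\Pi_6(\mathbf{k},\mathbf{k}')=\langle a_1,a_2,\alpha,\beta\mid [a_1,a_2]=1,\ \alpha a_i\alpha^{-1}=N(a_i),\ \beta a_i\beta^{-1}=M(a_i),\ \beta^2=\mathbf{a}^{\mathbf{k}},\ \beta\alpha\beta^{-1}=\mathbf{a}^{\mathbf{k}'}\alpha^{-1}\rangle.$$ These are crystallographic groups (SC-groups) of $\mathrm{Sol}=\mathbb{R}^2\rtimes\mathbb{R}$ ($t$ acting by $\mathrm{diag}(e^t,e^{-t})$), i.e. discrete cocompact subgroups of $\mathrm{Sol}\rtimes K$ with $K$ a maximal compact subgroup of $\mathrm{Aut}(\mathrm{Sol})$; an SB-group is a torsion free SC-group. The Reidemeister number $R(\varphi)$ of an endomorphism $\varphi$ of a group $G$ is the number (possibly $\infty$) of equivalence classes of the relation $\alpha\sim\gamma\alpha\varphi(\gamma)^{-1}$ ($\gamma\in G$) on $G$. $G$ has the $R_\infty$ property if $R(\varphi)=\infty$ for every automorphism $\varphi$ of $G$. *)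

(* Defs.v *)
From HB Require Import structures.
From mathcomp Require Import all_boot all_order all_algebra generic_quotient.
From mathcomp Require Import finmap.
From mathcomp Require Import boolp classical_sets functions cardinality reals.
From mathcomp Require Import constructive_ereal.

Set Implicit Arguments.
Unset Strict Implicit.
Unset Printing Implicit Defensive.

Local Open Scope quotient_scope.

(* Formal group expressions over a set S of generators.  They form a
   [baseGroupType] (operations without axioms), so that relators can be written
   with the usual group notations. *)
Inductive gterm (S : Type) : Type :=
  | GGen of S
  | GOne
  | GMul of gterm S & gterm S
  | GInv of gterm S.
Arguments GOne {S}.

HB.instance Definition _ (S : Type) := hasMul.Build (gterm S) (@GMul S).
HB.instance Definition _ (S : Type) := hasOne.Build (gterm S) (@GOne S).
HB.instance Definition _ (S : Type) := hasInv.Build (gterm S) (@GInv S).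
HB.instance Definition _ (S : Type) := gen_eqMixin (gterm S).
HB.instance Definition _ (S : Type) := gen_choiceMixin (gterm S).

Section Presentation.
Local Open Scope group_scope.
Variables (S : Type) (rels : set (gterm S * gterm S)).

(* The smallest congruence containing the group axioms and the relations
   u = v for (u, v) in [rels]. *)
Inductive gcongr : gterm S -> gterm S -> Prop :=
  | gc_rel u v : rels (u, v) -> gcongr u v
  | gc_refl u : gcongr u u
  | gc_sym u v : gcongr u v -> gcongr v u
  | gc_trans u v w : gcongr u v -> gcongr v w -> gcongr u w
  | gc_mul u u' v v' : gcongr u u' -> gcongr v v' -> gcongr (u * v) (u' * v')
  | gc_inv u u' : gcongr u u' -> gcongr u^-1 u'^-1
  | gc_mulA u v w : gcongr (u * (v * w)) (u * v * w)
  | gc_mul1 u : gcongr (1 * u) u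
  | gc_mulV u : gcongr (u^-1 * u) 1.

Definition gcongrb : rel (gterm S) := fun u v => `[< gcongr u v >].

Lemma gcongrb_refl : reflexive gcongrb.
Proof. by move=> u; apply/asboolP; apply: gc_refl. Qed.

Lemma gcongrb_sym : symmetric gcongrb.
Proof.
by move=> u v; apply/asboolP/asboolP; apply: gc_sym.
Qed.

Lemma gcongrb_trans : transitive gcongrb.
Proof.
move=> v u w /asboolP uv /asboolP vw; apply/asboolP; exact: gc_trans uv vw.
Qed.

Canonical gcongr_equiv :=
  EquivRel gcongrb gcongrb_refl gcongrb_sym gcongrb_trans.

(* The group < S | rels >. *)
Definition presented : Type := {eq_quot gcongr_equiv}.
HB.instance Definition _ := Choice.on presented.
HB.instance Definition _ := EqQuotient.on presented.

Definition pclass (u : gterm S) : presented := \pi_presented%qT u.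

Lemma pclassP u v : pclass u = pclass v <-> gcongr u v.
Proof.
split=> [/eqmodP/asboolP // | uv]; by apply/eqmodP/asboolP.
Qed.

Definition pone : presented := pclass 1.
Definition pmul (x y : presented) : presented := pclass (repr x * repr y).
Definition pinv (x : presented) : presented := pclass (repr x)^-1.

Lemma pclass_repr x : pclass (repr x) = x.
Proof. exact: reprK. Qed.

Lemma gcongr_repr u : gcongr (repr (pclass u)) u.
Proof. by apply/pclassP; rewrite pclass_repr. Qed.

Lemma pmulE u v : pmul (pclass u) (pclass v) = pclass (u * v).
Proof. by apply/pclassP; apply: gc_mul; apply: gcongr_repr. Qed.

Lemma pinvE u : pinv (pclass u) = pclass u^-1.
Proof. by apply/pclassP; apply: gc_inv; apply: gcongr_repr. Qed.

Lemma pmulA : associative pmul.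
Proof.
move=> x y z; rewrite -[x]pclass_repr -[y]pclass_repr -[z]pclass_repr !pmulE.
by apply/pclassP; apply: gc_mulA.
Qed.

Lemma pmul1 : left_id pone pmul.
Proof.
move=> x; rewrite -[x]pclass_repr pmulE; by apply/pclassP; apply: gc_mul1.
Qed.

Lemma pmulV : left_inverse pone pinv pmul.
Proof.
move=> x; rewrite -[x]pclass_repr pinvE pmulE; by apply/pclassP; apply: gc_mulV.
Qed.

Lemma pmulVr : right_inverse pone pinv pmul.
Proof.
move=> x; rewrite -[LHS]pmul1 -(pmulV (pinv x)) -pmulA [pmul (pinv x) _]pmulA.
by rewrite pmulV pmul1.
Qed.

Lemma pmulr1 : right_id pone pmul.
Proof. by move=> x; rewrite -(pmulV x) pmulA pmulVr pmul1. Qed.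

HB.instance Definition _ :=
  isGroup.Build presented pmulA pmul1 pmulr1 pmulV pmulVr.

End Presentation.

Section UniversalProperty.
Local Open Scope group_scope.
Variables (S : Type) (rels : set (gterm S * gterm S)) (H : groupType).

Fixpoint geval (f : S -> H) (u : gterm S) : H :=
  match u with
  | GGen s => f s
  | GOne => 1
  | GMul u v => geval f u * geval f v
  | GInv u => (geval f u)^-1
  end.

Lemma presented_lift (f : S -> H) :
    (forall u v, rels (u, v) -> geval f u = geval f v) ->
  exists2 h : presented rels -> H,
    {morph h : x y / x * y} & forall u, h (pclass rels u) = geval f u.
Proof.
move=> f_rels.
have f_congr u v : gcongr rels u v -> geval f u = geval f v.
  elim=> {u v} //=.
  - by move=> u v w _ -> _ ->.
  - by move=> u u' v v' _ -> _ ->.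
  - by move=> u u' _ ->.
  - by move=> u v w; rewrite mulgA.
  - by move=> u; rewrite mul1g.
  - by move=> u; rewrite mulVg.
have fE u : geval f (repr (pclass rels u)) = geval f u.
  by apply: f_congr; apply: gcongr_repr.
exists (fun x => geval f (repr x)) => [x y|u]; last exact: fE.
exact: (fE (repr x * repr y)).
Qed.

Lemma presented_lift_unique (h1 h2 : presented rels -> H) :
    {morph h1 : x y / x * y} -> {morph h2 : x y / x * y} ->
    (forall s, h1 (pclass rels (GGen s)) = h2 (pclass rels (GGen s))) ->
  h1 =1 h2.
Proof.
move=> h1M h2M h12 x.
have m1 (h : presented rels -> H) : {morph h : x y / x * y} -> h 1 = 1.
  by move=> hM; apply: (mulgI (h 1)); rewrite -hM !mulg1.
have mV (h : presented rels -> H) :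
    {morph h : x y / x * y} -> forall y, h y^-1 = (h y)^-1.
  move=> hM y; apply: (mulgI (h y)); rewrite -hM !mulgV; exact: m1.
rewrite -[x]pclass_repr; elim: (repr x) => [s||u IHu v IHv|u IHu] //.
- by rewrite -[pclass _ _]/(1 : presented rels) !m1.
- by rewrite -[GMul u v]/(u * v) -pmulE [LHS]h1M [RHS]h2M IHu IHv.
- by rewrite -[GInv u]/(u^-1) -pinvE [LHS]mV // [RHS]mV // IHu.
Qed.

End UniversalProperty.

Section Reidemeister.
Local Open Scope group_scope.
Local Open Scope classical_set_scope.
Variable G : groupType.

Definition torsion_free : Prop :=
  forall (g : G) (n : nat), (0 < n)%N -> g ^+ n = 1 -> g = 1.

Definition reidemeister_class (phi : G -> G) (a : G) : set G :=
  [set g * a * (phi g)^-1 | g in [set: G]].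

Definition reidemeister_number (phi : G -> G) : \bar nat :=
  let classes := range (reidemeister_class phi) in
  if `[< finite_set classes >] then EFin #|` fset_set classes|%fset else +oo%E.

Definition R_infty : Prop :=
  forall phi : {multiplicative G -> G},
    bijective phi -> reidemeister_number phi = +oo%E.

End Reidemeister.

Definition mx22 (T : Type) (a b c d : T) : 'M[T]_2 :=
  \matrix_(i, j) (if i == ord0 then (if j == ord0 then a else b)
                  else (if j == ord0 then c else d)).

Definition zexp (G : baseGroupType) (x : G) (n : int) : G :=
  match n with
  | Posz p => (x ^+ p)%g
  | Negz p => (x ^- p.+1)%g
  end.

(* [g_s] stands for the generator t of Pi_3 and for the generator alpha of
   Pi_6. *)
Inductive sol_gen : Type := g_a1 | g_a2 | g_s | g_beta.

Section SolGroups.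
Local Open Scope group_scope.
Local Open Scope classical_set_scope.

Let a1 := GGen g_a1.
Let a2 := GGen g_a2.
Let s := GGen g_s.
Let beta := GGen g_beta.

Definition apow (x : 'cV[int]_2) : gterm sol_gen :=
  zexp a1 (x ord0 ord0) * zexp a2 (x ord_max ord0).

(* With B(a_i) = apow (col i B), the relations
     [a1, a2] = 1,  s a_i s^-1 = B(a_i),  beta a_i beta^-1 = M(a_i),
     beta^2 = a^k,  beta s beta^-1 = a^k' s^-1
   shared by Pi_3 (where s = t, B = A) and Pi_6 (where s = alpha, B = N). *)
Definition sol_rels (B M : 'M[int]_2) (k k' : 'cV[int]_2) :
    set (gterm sol_gen * gterm sol_gen) :=
  [set ([~ a1, a2], 1);
       (s * a1 * s^-1, apow (col ord0 B));
       (s * a2 * s^-1, apow (col ord_max B));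
       (beta * a1 * beta^-1, apow (col ord0 M));
       (beta * a2 * beta^-1, apow (col ord_max M));
       (beta ^+ 2, apow k);
       (beta * s * beta^-1, apow k' * s^-1)].

End SolGroups.

Definition M3 (m : int) : 'M[int]_2 := mx22 (-1)%R m 0%R 1%R.

Definition Pi3 (A : 'M[int]_2) (m : int) (k k' : 'cV[int]_2) : groupType :=
  presented (sol_rels A (M3 m) k k').

Definition Pi6 (N M : 'M[int]_2) (k k' : 'cV[int]_2) : groupType :=
  presented (sol_rels N M k k').

Section SquareRoot.
Local Open Scope ring_scope.

(* The second conjunct alone forces N * N = A (Cayley-Hamilton, as \det A = 1).
   N and A are compared over R because the scalar is a real square root. *)
Definition is_int_sqrt (R : realType) (A N : 'M[int]_2) : Prop :=
  let l11 := A ord0 ord0 in let l12 := A ord0 ord_max in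
  let l21 := A ord_max ord0 in let l22 := A ord_max ord_max in
  N * N = A /\
  map_mx intr N =
    - (Num.sqrt (l11 + l22 + 2)%:~R)^-1
      *: map_mx intr (mx22 (l11 + 1) l12 l21 (l22 + 1)) :> 'M[R]_2.

End SquareRoot.

(* Main.v *)
Require Import Defs.
From HB Require Import structures.
From mathcomp Require Import all_boot all_order all_algebra reals.
From mathcomp Require Import boolp classical_sets cardinality.
From mathcomp Require Import constructive_ereal zify ring.

Set Implicit Arguments.
Unset Strict Implicit.
Unset Printing Implicit Defensive.

Import Order.TTheory GRing.Theory Num.Theory.
Local Open Scope ring_scope.

(** Both families are instances of one presentation, with [s] acting on
[<a1, a2>] by [B = A] or [B = N].  Killing [a1] and [a2] maps the group [G] onto
the infinite dihedral group D, with [s] going to the unit translation and [beta]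
to a reflection.  The theorem follows from two facts.

Every epimorphism from [G] to D kills [a1] and [a2]
([translations_trivial]).  The image of [<a1, a2>] is an abelian normal
subgroup of D, hence consists of translations; writing [u1], [u2] for the
translation lengths of [a1], [a2], the relations for [s] say that the row vector
[(u1, u2)] satisfies [u B = u] or [u B = - u], according to whether [s] goes to
a translation or to a reflection.  Neither 1 nor -1 is an eigenvalue of [B], so
[u = 0].  For [B = A] this is [det (A - 1) = 2 - tr A] and
[det (A + 1) = 2 + tr A]; for [B = N] it is
[det (N - 1) det (N + 1) = det (N^2 - 1) = det (A - 1)].

Applied to an automorphism of [G] followed by the projection to D, this shows
that the automorphism induces an endomorphism of D, and surjectivity forces it
to be [twist n b] with [n = 1] or [n = -1] ([image_generators]).

Twisted conjugacy for [twist n b] has infinitely many classes on D.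
Indeed [twist n b] is conjugation by the affine map [c : y |-> n y + b / 2] of
the real line, so [x |-> x c] turns twisted conjugacy classes into ordinary
conjugacy classes of isometries of the line, and the length of a translation is
a conjugation invariant ([twist_invariantP]).  Twisted classes in [G] map to
twisted classes in D, so there are infinitely many of them. *)

(** * Evaluation of group words *)

Section Evaluation.
Local Open Scope group_scope.
Variables (S : Type) (H : groupType).

Lemma zexp_closed (P : H -> Prop) :
    P 1 -> (forall x y, P x -> P y -> P (x * y)) -> (forall x, P x -> P x^-1) ->
  forall x n, P x -> P (zexp x n).
Proof.
move=> P1 PM PV x n Px.
have PX m : P (x ^+ m) by elim: m => // m; rewrite expgS; apply: PM.
by case: n => m //=; apply: PV.
Qed.

Lemma geval_closed (f : S -> H) (P : H -> Prop) :
    P 1 -> (forall x y, P x -> P y -> P (x * y)) -> (forall x, P x -> P x^-1) ->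
  (forall s, P (f s)) -> forall u, P (geval f u).
Proof. by move=> P1 PM PV Pf; elim=> //= [u Pu v Pv|u Pu]; auto. Qed.

Lemma geval_zexp (f : S -> H) u n : geval f (zexp u n) = zexp (geval f u) n.
Proof.
have gevalX m : geval f (u ^+ m) = geval f u ^+ m.
  by elim: m => [|[|m] IHm] //; rewrite expgSS expgS -IHm.
by case: n => m //=; rewrite -gevalX.
Qed.

Lemma morph_inv (G : groupType) (h : G -> H) :
  {morph h : x y / x * y} -> {morph h : x / x^-1}.
Proof.
move=> hM x; apply: (mulgI (h x)); rewrite -hM !mulgV.
by apply: (mulgI (h 1)); rewrite -hM !mulg1.
Qed.

Lemma morph_pclass (rels : set (gterm S * gterm S)) (h : presented rels -> H) :
    {morph h : x y / x * y} ->
  forall u, h (pclass rels u) = geval (fun s => h (pclass rels (GGen s))) u.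
Proof.
move=> hM.
elim=> [s||u IHu v IHv|u IHu] //=.
- by apply: (mulgI (h 1)); rewrite -hM !mulg1.
- rewrite -IHu -IHv -hM; apply: congr1; exact: esym (pmulE _ _ _).
- rewrite -IHu -(morph_inv hM); apply: congr1; exact: esym (pinvE _ _).
Qed.

End Evaluation.

(** * Infinitely many twisted conjugacy classes *)

Section TwistedInvariant.
Local Open Scope group_scope.

Lemma reidemeister_infinite (G : groupType) (T : Type)
    (phi : {multiplicative G -> G}) (inv : G -> T) (x : nat -> G) :
    (forall g y, inv (g * y * (phi g)^-1) = inv y) ->
    injective (inv \o x) ->
  reidemeister_number phi = +oo%E.
Proof.
move=> inv_phi inj_x; rewrite /reidemeister_number; case: asboolP => // fin.
have phi1 : phi 1 = 1 by apply: (mulgI (phi 1)); rewrite -gmulfM !mulg1.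
case: infinite_nat.
pose val (C : set G) := inv (xget 1 C).
have valE y : val (reidemeister_class phi y) = inv y.
  (* xget picks some element of the class, on which inv is constant *)
  rewrite /val; case: xgetP => [z _ [g _ <-]|]; first exact: inv_phi.
  by move=> /(_ y) []; exists 1 => //; rewrite phi1 invg1 mul1g mulg1.
have sub :
    (range (inv \o x) `<=` val @` range (reidemeister_class phi))%classic.
  by move=> _ [i _ <-]; exists (reidemeister_class phi (x i)); rewrite ?valE.
have finr := sub_finite_set sub (finite_image val fin).
apply: (@sub_finite_set _ _ ((inv \o x) @^-1` range (inv \o x))%classic).
  by move=> i _; exists i.
by apply: finite_preimage finr => i j _ _; apply: inj_x.
Qed.

End TwistedInvariant.

(** * The infinite dihedral group *)

(** The pair [(i, e)] stands for the isometry [y |-> (-1)^e y + i] of the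
integers. *)
Definition dihedral : Type := (int * bool)%type.
HB.instance Definition _ := Choice.on dihedral.

Definition dihedral_mul (x y : dihedral) : dihedral :=
  (x.1 + (-1) ^+ x.2 * y.1, x.2 (+) y.2).
Definition dihedral_one : dihedral := (0, false).
Definition dihedral_inv (x : dihedral) : dihedral :=
  (- ((-1) ^+ x.2 * x.1), x.2).

Lemma dihedral_mulA : associative dihedral_mul.
Proof.
move=> [x e] [y f] [z g]; rewrite /dihedral_mul /= addbA; congr pair.
by case: e; case: f; rewrite /= ?expr0 ?expr1; lia.
Qed.

Lemma dihedral_mul1 : left_id dihedral_one dihedral_mul.
Proof. by move=> [x e]; rewrite /dihedral_mul /= expr0 mul1r add0r. Qed.

Lemma dihedral_mulr1 : right_id dihedral_one dihedral_mul.
Proof. by move=> [x e]; rewrite /dihedral_mul /= mulr0 addr0 addbF. Qed.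

Lemma dihedral_mulV : left_inverse dihedral_one dihedral_inv dihedral_mul.
Proof. by move=> [x e]; rewrite /dihedral_mul /= addNr addbb. Qed.

Lemma dihedral_mulVr : right_inverse dihedral_one dihedral_inv dihedral_mul.
Proof.
by move=> [x []]; rewrite /dihedral_mul /dihedral_one /= ?expr0 ?expr1;
  congr pair; lia.
Qed.

HB.instance Definition _ :=
  isGroup.Build dihedral dihedral_mulA dihedral_mul1 dihedral_mulr1
    dihedral_mulV dihedral_mulVr.

Lemma dihedralM (i j : int) (e f : bool) :
  (((i, e) : dihedral) * ((j, f) : dihedral) =
    ((i + (-1) ^+ e * j)%R, e (+) f))%g.
Proof. by []. Qed.

Lemma dihedralV (i : int) (e : bool) :
  (((i, e) : dihedral)^-1 = ((- ((-1) ^+ e * i))%R, e))%g.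
Proof. by []. Qed.

Lemma dihedral1 : (1 = (0, false) :> dihedral)%g.
Proof. by []. Qed.

Lemma zexp_translation (i n : int) :
  zexp ((i, false) : dihedral) n = (n * i, false).
Proof.
have transX (m : nat) : (((i, false) : dihedral) ^+ m)%g = (m%:Z * i, false).
  elim: m => [|m IHm]; first by rewrite mul0r.
  by rewrite expgS IHm dihedralM expr0; congr pair; lia.
case: n => m /=; rewrite transX // dihedralV expr0; congr pair; lia.
Qed.

Lemma commute_reflection (i : int) (x : dihedral) :
  commute ((i, true) : dihedral) x -> x = 1%g \/ x = (i, true).
Proof.
case: x => j [] /=; rewrite /commute !dihedralM ?expr0 ?expr1 => -[ij].
  by right; congr pair; lia.
by left; rewrite dihedral1; congr pair; lia.
Qed.

(** * Twisted conjugacy in the infinite dihedral group *)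

Definition twist (n b : int) (x : dihedral) : dihedral :=
  (n * x.1 + (if x.2 then b else 0), x.2).

Lemma twistM n b : n * n = 1 -> {morph twist n b : x y / (x * y)%g}.
Proof.
move=> n1 [i e] [j f]; rewrite /twist !dihedralM /=; congr pair.
by case: e; case: f; rewrite /= ?expr0 ?expr1; lia.
Qed.

(** Twice the translation length of [x c], where [c : y |-> n y + b / 2] and [x]
is seen as an isometry of the line, when [x c] is a translation; 0 otherwise. *)
Definition twist_invariant (n b : int) (x : dihedral) : int :=
  if (-1) ^+ x.2 == n then `|2 * x.1 + n * b| else 0.

(** Conjugation by [c] induces [twist n b], so [g x (twist n b g)^-1 c] is the
conjugate [g (x c) g^-1], which has the same translation length as [x c]. *)
Lemma twist_invariantP n b (g x : dihedral) : n * n = 1 ->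
  twist_invariant n b (g * x * ((twist n b g) : dihedral)^-1)%g =
    twist_invariant n b x.
Proof.
move=> n1; have {n1} [->|->] : n = 1 \/ n = -1 by nia.
all: move: g x => [i e] [j f].
all: rewrite /twist_invariant /twist dihedralV !dihedralM /=.
all: case: e; case: f; rewrite /= ?expr0 ?expr1 ?eqxx //=; lia.
Qed.

(** * Small integer matrices *)

Lemma det_neq0_lker (R : idomainType) (n : nat) (X : 'M[R]_n) (u : 'rV[R]_n) :
  \det X != 0 -> u *m X = 0 -> u = 0.
Proof.
move=> dX uX; have: u *m X *m \adj X = 0 by rewrite uX mul0mx.
rewrite -mulmxA mul_mx_adj mul_mx_scalar => /rowP dXu; apply/rowP => j.
have := dXu j; rewrite !mxE => /eqP.
by rewrite mulf_eq0 (negPf dX) => /eqP.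
Qed.

Lemma lift0_ord2 : lift ord0 ord0 = ord_max :> 'I_2.
Proof. exact: val_inj. Qed.

Lemma det_mx22 (R : comNzRingType) (X : 'M[R]_2) :
  \det X = X ord0 ord0 * X ord_max ord_max - X ord0 ord_max * X ord_max ord0.
Proof.
have l1 : lift ord_max ord0 = ord0 :> 'I_2 by apply: val_inj.
rewrite (expand_det_row X ord0) !big_ord_recl big_ord0 /cofactor !det_mx11.
by rewrite !mxE !lift0_ord2 l1 /= !addn0 !add0n expr0 expr1; ring.
Qed.

Lemma mxtrace22 (R : comNzRingType) (X : 'M[R]_2) :
  \tr X = X ord0 ord0 + X ord_max ord_max.
Proof. by rewrite /mxtrace !big_ord_recl big_ord0 addr0 lift0_ord2. Qed.

(** * Epimorphisms onto the infinite dihedral group *)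

Section SolMorphisms.
Local Open Scope group_scope.
Variables (B M : 'M[int]_2) (k k' : 'cV[int]_2).
Hypotheses (detB1 : (\det (B - 1) != 0)%R) (detBN1 : (\det (B + 1) != 0)%R).
Variable f : sol_gen -> dihedral.
Hypothesis f_rels :
  forall u v, sol_rels B M k k' (u, v) -> geval f u = geval f v.
Hypothesis f_surj : forall d, exists u, geval f u = d.

Let a1 := f g_a1.
Let a2 := f g_a2.
Let s := f g_s.
Let beta := f g_beta.

Let fpow (x : 'cV[int]_2) := zexp a1 (x ord0 ord0) * zexp a2 (x ord_max ord0).

Lemma sol_relsE :
  [/\ commute a1 a2,
      s * a1 * s^-1 = fpow (col ord0 B) /\ s * a2 * s^-1 = fpow (col ord_max B),
      beta * a1 * beta^-1 = fpow (col ord0 M) /\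
        beta * a2 * beta^-1 = fpow (col ord_max M),
      beta * beta = fpow k &
      beta * s * beta^-1 = fpow k' * s^-1].
Proof.
have apowE x : geval f (apow x) = fpow x by rewrite /= !geval_zexp.
split; [|split|split| |]; rewrite -?apowE.
- apply/commgP/eqP; apply: (@f_rels [~ GGen g_a1, GGen g_a2] 1).
  by rewrite /sol_rels /=; tauto.
- apply: (@f_rels (GGen g_s * GGen g_a1 * (GGen g_s)^-1) (apow _)).
  by rewrite /sol_rels /=; tauto.
- apply: (@f_rels (GGen g_s * GGen g_a2 * (GGen g_s)^-1) (apow _)).
  by rewrite /sol_rels /=; tauto.
- apply: (@f_rels (GGen g_beta * GGen g_a1 * (GGen g_beta)^-1) (apow _)).
  by rewrite /sol_rels /=; tauto.
- apply: (@f_rels (GGen g_beta * GGen g_a2 * (GGen g_beta)^-1) (apow _)).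
  by rewrite /sol_rels /=; tauto.
- apply: (@f_rels (GGen g_beta ^+ 2) (apow _)).
  by rewrite /sol_rels /=; tauto.
- apply: (@f_rels (GGen g_beta * GGen g_s * (GGen g_beta)^-1)
    (apow k' * (GGen g_s)^-1)).
  by rewrite /sol_rels /=; tauto.
Qed.

Lemma image_generated (P : dihedral -> Prop) :
    P 1 -> (forall x y, P x -> P y -> P (x * y)) -> (forall x, P x -> P x^-1) ->
    P a1 -> P a2 -> P s -> P beta ->
  forall d, P d.
Proof.
move=> P1 PM PV Pa1 Pa2 Ps Pbeta d; have [u <-] := f_surj d.
by apply: geval_closed => // -[].
Qed.

(** If the images of [a1] and [a2] lay in [{1, r}] for a reflection [r] among
them, this subgroup of order 2 would be normal, as the relations express the
conjugates of [a1] and [a2] by words in [a1] and [a2].  So [r] would be central,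
whereas it does not commute with the unit translation. *)
Lemma reflection_not_normal (i : int) :
    a1 = (i, true) \/ a2 = (i, true) ->
    a1 = 1 \/ a1 = (i, true) -> a2 = 1 \/ a2 = (i, true) -> False.
Proof.
pose r : dihedral := (i, true); rewrite -/r => r_a a1r a2r.
have r2 : r * r = 1 by rewrite dihedralM expr1; congr pair; lia.
have rV : r^-1 = r by apply: (mulgI r); rewrite mulgV r2.
have [_ [sa1 sa2] [ba1 ba2] _ _] := sol_relsE.
have fpow_r x : fpow x = 1 \/ fpow x = r.
  pose P (y : dihedral) := y = 1 \/ y = r.
  have P1 : P 1 by left.
  have PM y z : P y -> P z -> P (y * z).
    by case=> ->; case=> ->; rewrite /P ?mul1g ?mulg1 ?r2; auto.
  have PV y : P y -> P y^-1 by case=> ->; rewrite /P ?invg1 ?rV; auto.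
  by apply: (PM); apply: (zexp_closed P1 PM PV).
have conj_r g x : g * r * g^-1 = fpow x -> commute g r.
  move=> gr; case: (fpow_r x) gr => -> gr; last first.
    by rewrite /commute -[in RHS]gr mulgVK.
  suff: r = 1 by [].
  by apply: (mulgI g); apply: (mulIg g^-1); rewrite gr mulg1 mulgV.
have cs : commute s r
  by case: r_a => ra; apply: conj_r; rewrite -ra; eassumption.
have cb : commute beta r
  by case: r_a => ra; apply: conj_r; rewrite -ra; eassumption.
have c1 : commute a1 r by case: a1r => ->; [exact/commute_sym/commute1|].
have c2 : commute a2 r by case: a2r => ->; [exact/commute_sym/commute1|].
have: commute ((1%R, false) : dihedral) r.
  apply: (image_generated (P := fun d => commute d r)) => //.
  - exact/commute_sym/commute1.
  - by move=> x y cx cy; apply/commute_sym/commuteM; apply/commute_sym.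
  - by move=> x cx; apply/commute_sym/commuteV/commute_sym.
by rewrite /commute /r !dihedralM expr0 expr1 => -[]; lia.
Qed.

(** The centralizer of a reflection [r] is [{1, r}]: if one of the commuting
elements [a1], [a2] went to [r], both would land in [{1, r}]. *)
Lemma translations_not_reflections : a1.2 = false /\ a2.2 = false.
Proof.
have [c12 _ _ _ _] := sol_relsE.
have c21 := commute_sym c12.
case E1: a1 c12 c21 => [i [|]] c12 c21 /=.
  case: (@reflection_not_normal i); rewrite ?E1; auto.
  exact: commute_reflection c12.
case E2: a2 c12 c21 => [j [|]] c12 c21 //=.
case: (@reflection_not_normal j); rewrite ?E1 ?E2; auto.
exact: commute_reflection c21.
Qed.

(** The image of [s] conjugates translations by a sign, so the vector of
translation lengths is a left eigenvector of [B] for 1 or -1, unless it is 0. *)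
Lemma translations_trivial : a1 = 1 /\ a2 = 1.
Proof.
have [_ [sa1 sa2] _ _ _] := sol_relsE.
have [r1 r2] := translations_not_reflections.
move: sa1 sa2; rewrite /fpow.
case: a1 r1 => u1 e1 /= ->; case: a2 r2 => u2 e2 /= ->.
rewrite !zexp_translation !mxE; case: s => n e.
rewrite dihedralV !dihedralM /= expr0 !addbF => -[s1] _ [s2] _.
pose u : 'rV[int]_2 := \row_j (if j == ord0 then u1 else u2).
have uB : (u *m B = (-1) ^+ e *: u)%R.
  apply/rowP => j; rewrite !mxE !big_ord_recl big_ord0 !mxE /=.
  rewrite lift0_ord2; have [->|->] : j = ord0 \/ j = ord_max.
    by case: j => -[|[|//]] jlt; [left|right]; apply: val_inj.
  - by case: (e) s1 => /=; rewrite ?expr0 ?expr1; lia.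
  - by case: (e) s2 => /=; rewrite ?expr0 ?expr1; lia.
have u0 : u = 0%R.
  case: e uB {s1 s2} => uB.
    apply: (det_neq0_lker detBN1).
    by rewrite mulmxDr mulmx1 uB expr1 scaleN1r addNr.
  apply: (det_neq0_lker detB1).
  by rewrite mulmxBr mulmx1 uB expr0 scale1r subrr.
have := congr1 (fun v : 'rV_2 => (v ord0 ord0, v ord0 ord_max)) u0.
by rewrite !mxE /= => -[-> ->].
Qed.

Lemma image_not_order2 (x : dihedral) : x * x = 1 ->
  s = 1 \/ s = x -> beta = 1 \/ beta = x -> False.
Proof.
move=> x2 sx bx; have [a1E a2E] := translations_trivial.
have xV : x^-1 = x by apply: (mulgI x); rewrite mulgV x2.
have P d : d = 1 \/ d = x.
  apply: (image_generated (P := fun d => d = 1 \/ d = x)); auto.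
  - move=> y z; case=> ->; case=> ->; rewrite ?mul1g ?mulg1 ?x2; auto.
  - move=> y; case=> ->; rewrite ?invg1 ?xV; auto.
case: (P (1%R, false)) => // e1; case: (P (2%R, false)) => //.
by rewrite -e1.
Qed.

(** Once [a1] and [a2] die, [beta^2 = 1] and [beta s beta^-1 = s^-1] hold in the
image.  Unless [beta] goes to a reflection and [s] to a translation, the image
has at most two elements.  If [s] goes to translation by [n], all translations
in the image are by multiples of [n], so [n] is a unit. *)
Lemma image_generators :
  exists n b : int, [/\ (n * n = 1)%R, a1 = 1, a2 = 1, s = (n, false) &
    beta = (b, true)].
Proof.
have [a1E a2E] := translations_trivial.
have [_ _ _ b2 bs] := sol_relsE.
have fpow1 x : fpow x = 1.
  have z1 (n : int) : zexp (1 : dihedral) n = 1.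
    by rewrite dihedral1 zexp_translation mulr0.
  by rewrite /fpow a1E a2E !z1 mulg1.
move: b2 bs; rewrite !fpow1 mul1g => b2 bs.
case Eb : beta b2 bs => [b [|]] b2 bs; last first.
  have bE : beta = 1.
    move: b2; rewrite Eb dihedralM expr0 dihedral1 => -[] b0.
    by congr pair; lia.
  case: (@image_not_order2 s); auto.
  move: bs; rewrite -Eb bE mul1g invg1 mulg1 => /(congr1 (fun y => s * y)).
  by rewrite mulgV.
case Es : s bs => [n [|]] bs.
  case: (@image_not_order2 beta); auto; first by rewrite Eb.
  right; rewrite Eb Es; congr pair.
  by move: bs; rewrite !dihedralV !dihedralM /= ?expr0 ?expr1 => -[]; lia.
exists n, b; split => //.
pose P (d : dihedral) := exists m, (d.1 = n * m + if d.2 then b else 0)%R.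
(* P defines a subgroup containing the generators of the image *)
have [m /=] : P (1%R, false); last first.
  rewrite addr0 => nm; have: (`|n| * `|m| == 1)%N by rewrite -abszM -nm.
  by rewrite muln_eq1 => /andP[/eqP n1 _]; nia.
apply: (image_generated (P := P)).
- by exists 0%R; rewrite /=; lia.
- move=> [x e] [y f'] [m1 /= ->] [m2 /= ->]; exists (m1 + (-1) ^+ e * m2)%R.
  by rewrite /=; case: (e); case: (f'); rewrite /= ?expr0 ?expr1; lia.
- move=> [x e] [m /= ->]; exists (- (-1) ^+ e * m)%R.
  by rewrite /=; case: (e); rewrite /= ?expr0 ?expr1; lia.
- by rewrite a1E; exists 0%R; rewrite /=; lia.
- by rewrite a2E; exists 0%R; rewrite /=; lia.
- by rewrite Es; exists 1%R; rewrite /=; lia.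
- by rewrite Eb; exists 0%R; rewrite /=; lia.
Qed.

End SolMorphisms.

(** * The R-infinity property *)

Definition dihedral_gen (g : sol_gen) : dihedral :=
  match g with
  | g_a1 | g_a2 => 1%g
  | g_s => (1, false)
  | g_beta => (0, true)
  end.

Lemma dihedral_gen_rels B M k k' u v :
  sol_rels B M k k' (u, v) -> geval dihedral_gen u = geval dihedral_gen v.
Proof.
have apow1 x : geval dihedral_gen (apow x) = 1%g.
  by rewrite /= !geval_zexp /= dihedral1 !zexp_translation !mulr0.
move=> [[[[[[uv|uv]|uv]|uv]|uv]|uv]|uv]; case: uv => -> ->; rewrite ?apow1 //.
by rewrite -[RHS]/(geval dihedral_gen (apow k') * _)%g apow1.
Qed.

Lemma geval_dihedral_gen (i : int) (e : bool) :
  geval dihedral_gen (zexp (GGen g_s) i * (if e then GGen g_beta else 1))%g =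
    (i, e).
Proof.
rewrite /= geval_zexp /= zexp_translation.
by case: e; rewrite dihedralM expr0; congr pair; lia.
Qed.

(** With [p] the projection onto the infinite dihedral group, [p \o phi] is
another epimorphism, so it equals [twist n b \o p], and [twist_invariant n b]
composed with [p] is constant on the twisted conjugacy classes of [phi]. *)
Lemma sol_R_infty (B M : 'M[int]_2) (k k' : 'cV[int]_2) :
    \det (B - 1) != 0 -> \det (B + 1) != 0 ->
  R_infty (presented (sol_rels B M k k')).
Proof.
move=> dB dBN phi phi_bij.
have [p pM pE] := presented_lift (@dihedral_gen_rels B M k k').
pose q x := p (phi x).
have qM : {morph q : x y / (x * y)%g} by move=> x y; rewrite /q gmulfM pM.
pose f g := q (pclass (sol_rels B M k k') (GGen g)).
have qE : forall u, q (pclass _ u) = geval f u := morph_pclass qM.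
have f_rels u v : sol_rels B M k k' (u, v) -> geval f u = geval f v.
  by move=> uv; rewrite -!qE; congr q; apply/pclassP/gc_rel.
have f_surj d : exists u, geval f u = d.
  have [psi _ psiK] := phi_bij; case: d => i e.
  rewrite -geval_dihedral_gen -pE -[X in p X]psiK -/(q _).
  by rewrite -[psi _]pclass_repr qE; eexists.
have [n [b [n1 f1 f2 f3 f4]]] := image_generators dB dBN f_rels f_surj.
have qp : q =1 twist n b \o p.
  apply: presented_lift_unique => //.
    by move=> x y; rewrite /= pM twistM.
  by case; rewrite /= pE -/(f _) ?f1 ?f2 ?f3 ?f4 ?dihedral1 /twist /=;
    congr pair; lia.
(* The invariant of the class of x i is 2 (i + |b|) + n b: the reflection part
   makes (-1)^e = n, and the shift by |b| keeps the expression nonnegative, so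
   that the absolute value is injective in i. *)
pose x (i : nat) := pclass (sol_rels B M k k')
  (zexp (GGen g_s) (i%:Z + `|b|)%R * (if n != 1%R then GGen g_beta else 1))%g.
apply: (reidemeister_infinite (inv := twist_invariant n b \o p) (x := x)).
  move=> g y; rewrite /= !pM (morph_inv pM) -/(q g) qp /=.
  exact: twist_invariantP.
have px i : p (x i) = (i%:Z + `|b|, n != 1).
  by rewrite /x pE geval_dihedral_gen.
move=> i j; rewrite /= !px /twist_invariant /=.
have {n1 f3 qp x px} [->|->] : n = 1 \/ n = -1 by nia.
all: by rewrite /= ?expr0 ?expr1 ?eqxx; lia.
Qed.

Theorem theorem3p3 (A : 'M[int]_2) (detA : \det A = 1) (trA : 2 < \tr A) :
  (forall (m : int) (k k' : 'cV[int]_2),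
      m = 0 \/ m = 1 ->
      M3 m * A * (M3 m)^-1 = A^-1 ->
      (1 - M3 m) *m k = 0 ->
      (A - M3 m) *m (k' - k) = 0 ->
      torsion_free (Pi3 A m k k') ->
      R_infty (Pi3 A m k k'))
  /\
  (forall (R : realType) (N M : 'M[int]_2) (k k' : 'cV[int]_2),
      is_int_sqrt R A N ->
      \tr M = 0 ->
      \det M = -1 ->
      M * A * M^-1 = A^-1 ->
      (1 - M) *m k = 0 ->
      (N - M) *m (k' - k) = 0 ->
      torsion_free (Pi6 N M k k') ->
      R_infty (Pi6 N M k k')).
Proof.
have dA : \det (A - 1) = 2 - \tr A.
  by move: detA; rewrite !det_mx22 mxtrace22 !mxE /=; lia.
have dAN : \det (A + 1) = 2 + \tr A.
  by move: detA; rewrite !det_mx22 mxtrace22 !mxE /=; lia.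
split=> [m k k' _ _ _ _ _ | R N M k k' [NN _] _ _ _ _ _ _].
  by apply: sol_R_infty; rewrite ?dA ?dAN; lia.
have dN : \det (N - 1) * \det (N + 1) = \det (A - 1).
  rewrite -det_mulmx -NN -[(_ *m _)%R]/((N - 1) * (N + 1)).
  by rewrite -expr2 -subr_sqr_1.
by apply: sol_R_infty; apply/eqP => d0; move: dN; rewrite d0 dA; lia.
Qed.
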